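(* The space $L$ equipped with the Lie bracket $[\cdot,\cdot]_0$ and the product $\widehat{\blacktriangleright}$ is a post-Lie algebra. Furthermore, the Lie bracket $[[x,y]]=[x,y]_0+x\,\widehat{\blacktriangleright}\,y-y\,\widehat{\blacktriangleright}\,x$ is equal to the original Lie bracket $[x,y]$ on $L$.
   Context: Here $\mathbb{N}=\{0,1,2,\dots\}$, $d\ge0$ is fixed, and $e_0,\dots,e_d$ is the canonical basis of $\mathbb{N}^{d+1}$. Post-Lie algebra. A post-Lie algebra is a Lie algebra $(\mathfrak{g},[\cdot,\cdot])$ with a bilinear product $\triangleright$ such that for all $x,y,z\in\mathfrak g$: $x\triangleright[y,z]=[x\triangleright y,z]+[y,x\triangleright z]$ and $[x,y]\triangleright z=a_\triangleright(x,y,z)-a_\triangleright(y,x,z)$, where $a_\triangleright(x,y,z)=x\triangleright(y\triangleright z)-(x\triangleright y)\triangleright z$. Multi-indices. Let $(z_k)_{k\in\mathbb{N}}$ and $(z_n)_{n\in\mathbb{N}^{d+1}\setminus\{0\}}$ be two disjoint families of commuting variables. A multi-index $\gamma$ is a finitely supported function with values in $\mathbb{N}$ on the disjoint union $\mathbb{N}\sqcup(\mathbb{N}^{d+1}\setminus\{0\})$, and $z^\gamma=\prod_kz_k^{\gamma(k)}\prod_nz_n^{\gamma(n)}$. Set $[\gamma]=\sum_{k\ge0}k\,\gamma(k)-\sum_{n\ne0}\gamma(n)$. Derivations on polynomials in these variables: $D^{(0)}=\sum_{k\in\mathbb{N}}(k+1)z_{k+1}\partial_{z_k}$; $D^{(n)}=\partial_{z_n}$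 for $n\in\mathbb{N}^{d+1}\setminus\{0\}$; $\partial_i=\sum_{n\in\mathbb{N}^{d+1}}(n_i+1)z_{n+e_i}D^{(n)}$ for $i\in\{0,\dots,d\}$. For such a derivation $D$, the coefficients $(D)^{\gamma}_{\beta}$ are defined by $D z^\gamma=\sum_\beta (D)^\gamma_\beta z^\beta$. Spaces. $\tilde L$ is the real vector space with basis $\{z^\gamma D^{(n)}:[\gamma]\ge0,\ n\in\mathbb{N}^{d+1}\}$ and $L$ is the real vector space with basis $\{z^\gamma D^{(n)}:[\gamma]\ge0,\ n\in\mathbb{N}^{d+1}\}\cup\{\partial_0,\dots,\partial_d\}$. On $\tilde L$ one has the pre-Lie product $z^\gamma D^{(n)}\blacktriangleright z^{\gamma'}D^{(n')}=\sum_{\beta'}(z^\gamma D^{(n)})^{\gamma'}_{\beta'}z^{\beta'}D^{(n')}$. The original Lie bracket on $L$ is $[z^{\gamma}D^{(n)},z^{\gamma'}D^{(n')}]=\sum_{\beta'}(z^{\gamma}D^{(n)})^{\gamma'}_{\beta'}z^{\beta'}D^{(n')}-\sum_{\beta}(z^{\gamma'}D^{(n')})^{\gamma}_{\beta}z^{\beta}D^{(n)}$, $[\partial_i,\partial_j]=0$, $[z^{\gamma}D^{(n)},\partial_i]=n_iz^{\gamma}D^{(n-e_i)}-\sum_{\beta}(\partial_i)^{\gamma}_{\beta}z^{\beta}D^{(n)}$ (terms $n_iz^\gamma D^{(n-e_i)}$ are $0$ when $n_i=0$). The bracket $[\cdot,\cdot]_0$ on $L$ is the antisymmetric bilinear map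 vanishing on $\tilde L\times\tilde L$ and on pairs from the span of the $\partial_i$, with $[z^\gamma D^{(n)},\partial_i]_0=n_iz^\gamma D^{(n-e_i)}$. The bilinear product $\widehat{\blacktriangleright}$ on $L$ is $x\,\widehat{\blacktriangleright}\,y=x\blacktriangleright y$ for $x,y\in\tilde L$, $\partial_i\,\widehat{\blacktriangleright}\,z^\gamma D^{(n)}=(\partial_iz^\gamma)D^{(n)}=\sum_\beta(\partial_i)^\gamma_\beta z^\beta D^{(n)}$, $z^\gamma D^{(n)}\,\widehat{\blacktriangleright}\,\partial_i=0$, $\partial_i\,\widehat{\blacktriangleright}\,\partial_j=0$. *)

(* Defs.v *)
From HB Require Import structures.
From mathcomp Require Import all_boot all_order all_algebra.
From mathcomp Require Import finmap.
From mathcomp Require Import boolp classical_sets functions cardinality fsbigop.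
From mathcomp Require Import reals.
From mathcomp Require Import monalg.

Set Implicit Arguments.
Unset Strict Implicit.
Unset Printing Implicit Defensive.

Import Order.TTheory GRing.Theory Num.Theory.

Local Open Scope classical_set_scope.
Local Open Scope ring_scope.

Section PostLie.
Context (R : comNzRingType) (V : lmodType R).
Implicit Types (br tri : V -> V -> V) (x y z : V).

Record is_lie_bracket br : Prop := IsLieBracket {
  lie_bilinear : bilinear_for *:%R *:%R br;
  lie_alternating : forall x, br x x = 0;
  lie_jacobi : forall x y z, br x (br y z) + br y (br z x) + br z (br x y) = 0
}.

Definition associator tri x y z : V := tri x (tri y z) - tri (tri x y) z.

Record is_post_lie br tri : Prop := IsPostLie {
  post_lie_lie : is_lie_bracket br;
  post_lie_bilinear : bilinear_for *:%R *:%R tri;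
  post_lie_derivation : forall x y z,
    tri x (br y z) = br (tri x y) z + br y (tri x z);
  post_lie_associator : forall x y z,
    tri (br x y) z = associator tri x y z - associator tri y x z
}.

End PostLie.

(* Bilinear extension of a map given on the basis elements [<< k >>]. *)
Definition bilin_ext (R : comNzRingType) (J K : choiceType) (V : lmodType R)
    (b : J -> K -> V) (x : {malg R[J]}) (y : {malg R[K]}) : V :=
  \sum_(j <- msupp x) \sum_(k <- msupp y) (x@_j * y@_k) *: b j k.

Notation nvec d := {ffun 'I_d.+1 -> nat}.

Definition evec d (i : 'I_d.+1) : nvec d := [ffun j => nat_of_bool (i == j)].

Lemma add_evec_neq0 d (n : nvec d) (i : 'I_d.+1) : n + evec i != 0.
Proof.
apply/eqP => /ffunP/(_ i); rewrite !ffunE eqxx.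
by rewrite -[RHS]/0%N -[LHS]/(n i + 1)%N addn1.
Qed.

(* Truncated componentwise; only ever used with the coefficient [n i]. *)
Definition sub_evec d (n : nvec d) (i : 'I_d.+1) : nvec d :=
  [ffun j => (n j - (i == j))%N].

Definition zindex d : choiceType := (nat + {n : nvec d | n != 0})%type.

Notation midx d := {cmonom zindex d}.

(* The integer written [gamma] in square brackets. *)
Definition mdegree d (g : midx d) : int :=
  \sum_(v <- finsupp g)
    match v with inl k => (k * g v)%N%:Z | inr _ => - (g v)%:Z end.

Section Derivations.
Context (R : comNzRingType) (d : nat).
Local Notation poly := {malg R[midx d]}.
Implicit Types (P : poly) (n : nvec d) (i : 'I_d.+1) (g b : midx d) (v : zindex d).

Definition zmon g : poly := << g >>.

Definition zk (k : nat) : poly := zmon (ucm (inl k)).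
Definition zn (m : {n : nvec d | n != 0}) : poly := zmon (ucm (inr m)).

Definition pderiv v P : poly :=
  \sum_(g <- msupp P) (P@_g * (g v)%:R) *: zmon (divcm g (ucm v)).

(* [\sum_(_ \in _)] is 0 when infinitely many terms are nonzero; by [D0_finite]
   and [dpart_finite] this never happens in the next two sums. *)
Definition D0 P : poly :=
  \sum_(k \in [set: nat]) k.+1%:R *: (zk k.+1 * pderiv (inl k) P).

Definition Dn n P : poly :=
  if insub n is Some m then pderiv (inr m) P else D0 P.

Definition dpart i P : poly :=
  \sum_(n \in [set: nvec d])
    (n i).+1%:R *: (zn (Sub (n + evec i) (add_evec_neq0 n i)) * Dn n P).

Definition zD_op g n P : poly := zmon g * Dn n P.

Definition dcoef (T : poly -> poly) g b : R := (T (zmon g))@_b.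

Lemma pderiv_finite P :
  exists X : {fset zindex d}, forall v, v \notin X -> pderiv v P = 0.
Proof.
exists (\bigcup_(g <- msupp P) finsupp g)%fset => v vX.
rewrite /pderiv big_seq big1 // => g gP.
suff -> : g v = 0%N by rewrite mulr0 scale0r.
apply/eqP; rewrite cmE_eq0; apply: contra vX => vg.
by apply/bigfcupP; exists g => //; rewrite gP.
Qed.

Lemma D0_finite P : finite_set
  [set k | k.+1%:R *: (zk k.+1 * pderiv (inl k) P) != 0].
Proof.
have [X XP] := pderiv_finite P.
apply: (@sub_finite_set _ _ [set` (pmap (fun v : zindex d =>
  if v is inl k then Some k else None) X)]); last exact: finite_seq.
move=> k /= knz; rewrite mem_pmap; apply/mapP.
have kX : inl k \in X.
  by apply: contra_neqT knz => /XP ->; rewrite mulr0 scaler0.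
by exists (inl k).
Qed.

Lemma dpart_finite i P : finite_set
  [set n : nvec d | (n i).+1%:R *:
     (zn (Sub (n + evec i) (add_evec_neq0 n i)) * Dn n P) != 0].
Proof.
have [X XP] := pderiv_finite P.
apply: (@sub_finite_set _ _ [set` (0 :: pmap (fun v : zindex d =>
  if v is inr n then Some (val n) else None) X)]); last exact: finite_seq.
move=> n /= nnz; rewrite inE; case: eqVneq => //= n0.
rewrite mem_pmap; apply/mapP; move: nnz; rewrite /Dn insubT => nnz.
have nX : inr (Sub n n0) \in X.
  by apply: contra_neqT nnz => /XP ->; rewrite mulr0 scaler0.
by exists (inr (Sub n n0)).
Qed.

Definition vdegree v : int := if v is inl k then k%:Z else -1.

Lemma mdegreeEw g (X : {fset zindex d}) : (finsupp g `<=` X)%fset ->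
  mdegree g = \sum_(v <- X) vdegree v * (g v)%:Z.
Proof.
move=> gX; have -> : mdegree g = \sum_(v <- finsupp g) vdegree v * (g v)%:Z.
  by apply: eq_bigr => -[k|m] _ /=; rewrite ?PoszM ?mulN1r.
apply: big_fset_incl => // v _; rewrite -cmE_eq0 => /eqP->.
by rewrite mulr0.
Qed.

Lemma mdegreeM g b : mdegree (mmul g b) = mdegree g + mdegree b.
Proof.
rewrite (mdegreeEw (fsubset_refl _)) mdomD.
rewrite (mdegreeEw (fsubsetUl (finsupp g) (finsupp b))).
rewrite (mdegreeEw (fsubsetUr (finsupp g) (finsupp b))).
by rewrite -big_split; apply: eq_bigr => v _; rewrite cmM PoszD mulrDr.
Qed.

Lemma mdegreeU v : mdegree (ucm v) = vdegree v.
Proof.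
by rewrite (mdegreeEw (fsubset_refl _)) mdomU big_seq_fset1 cmUU mulr1.
Qed.

Lemma mdegree_div g v : g v != 0%N ->
  mdegree (divcm g (ucm v)) = mdegree g - vdegree v.
Proof.
move=> gv; rewrite -mdegreeU; apply/(addIr (mdegree (ucm v))).
rewrite subrK -mdegreeM; congr mdegree; apply/eqP/cmP => w.
rewrite cmM divcmE subnK // cmU; case: eqVneq => [<-|//].
by rewrite lt0n.
Qed.

Definition deg_ge (c : int) P := forall b, P@_b != 0 -> c <= mdegree b.

Lemma deg_ge_sum (c : int) (I : Type) (r : seq I) (F : I -> poly) :
  (forall j, deg_ge c (F j)) -> deg_ge c (\sum_(j <- r) F j).
Proof.
move=> Fc; apply: (big_ind (deg_ge c)) => [b|P Q Pc Qc b|j _]; last exact: Fc.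
  by rewrite mcoeff0 eqxx.
rewrite mcoeffD; have [P0|/Pc //] := eqVneq P@_b 0.
by rewrite P0 add0r => /Qc.
Qed.

Lemma deg_geZ (c : int) (a : R) P : deg_ge c P -> deg_ge c (a *: P).
Proof.
move=> Pc b; rewrite mcoeffZ => aP; apply: Pc.
by apply: contraNneq aP => ->; rewrite mulr0.
Qed.

Lemma deg_ge_mono g : deg_ge (mdegree g) (zmon g).
Proof. by move=> b; rewrite mcoeffU1; case: (g =P b) => [->|]; rewrite ?eqxx. Qed.

Lemma deg_geM (c e : int) P Q : deg_ge c P -> deg_ge e Q -> deg_ge (c + e) (P * Q).
Proof.
move=> Pc Qe b; rewrite mcoeff_neq0 => /(fsubsetP (msuppM_incl P Q)).
case/imfset2P=> /= g gP [h hQ ->].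
by rewrite mdegreeM lerD ?Pc ?Qe ?mcoeff_neq0.
Qed.

Lemma deg_ge_pderiv (c : int) v P :
  deg_ge c P -> deg_ge (c - vdegree v) (pderiv v P).
Proof.
move=> Pc; rewrite /pderiv big_seq_cond big_mkcond; apply: deg_ge_sum => g.
case: ifP => [/andP[gP _]|_]; last by move=> b; rewrite mcoeff0 eqxx.
have [->|gv] := eqVneq (g v) 0%N.
  by rewrite mulr0 scale0r => b; rewrite mcoeff0 eqxx.
apply: deg_geZ => b /deg_ge_mono; apply: le_trans.
by rewrite mdegree_div // lerB // Pc ?mcoeff_neq0.
Qed.

Lemma deg_ge_Dn (c : int) n P : deg_ge c P -> deg_ge (c + 1) (Dn n P).
Proof.
move=> Pc; rewrite /Dn; case: insubP => [m _ _|_].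
  by rewrite -[1]opprK; apply: (@deg_ge_pderiv _ (inr m)).
apply: deg_ge_sum => k; apply: deg_geZ.
have -> : c + 1 = mdegree (ucm (inl k.+1 : zindex d)) + (c - k%:Z).
  by rewrite mdegreeU /= -addn1 PoszD [RHS]addrC addrA subrK.
by apply: deg_geM; [exact: deg_ge_mono | exact: (@deg_ge_pderiv _ (inl k))].
Qed.

Lemma deg_ge_dpart (c : int) i P : deg_ge c P -> deg_ge c (dpart i P).
Proof.
move=> Pc; apply: deg_ge_sum => n; apply: deg_geZ.
set m := Sub _ _; have -> : c = mdegree (ucm (inr m : zindex d)) + (c + 1).
  by rewrite mdegreeU addrCA addNr addr0.
by apply: deg_geM; [exact: deg_ge_mono | exact: deg_ge_Dn].
Qed.

Lemma dcoef_zD_op_mdegree g n g' b : 0 <= mdegree g -> 0 <= mdegree g' ->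
  dcoef (zD_op g n) g' b != 0 -> 0 <= mdegree b.
Proof.
move=> g0 g'0; suff : deg_ge 0 (zD_op g n (zmon g')) by apply.
move=> h /(deg_geM (@deg_ge_mono g) (deg_ge_Dn (@deg_ge_mono g'))).
by apply: le_trans; rewrite !addr_ge0.
Qed.

Lemma dcoef_dpart_mdegree i g b : 0 <= mdegree g ->
  dcoef (dpart i) g b != 0 -> 0 <= mdegree b.
Proof.
move=> g0; suff : deg_ge 0 (dpart i (zmon g)) by apply.
by apply: deg_ge_dpart => h /deg_ge_mono; apply: le_trans.
Qed.

End Derivations.

(* [z^g D^(n)] is the basis element [<< (g, n) >>] when [0 <= mdegree g]. *)
Definition pidx d : choiceType := {g : midx d | 0 <= mdegree g}.
Definition Lsub_basis d : choiceType := (pidx d * nvec d)%type.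
Definition Lspace_basis d : choiceType := (Lsub_basis d + 'I_d.+1)%type.
Notation Lsub R d := {malg R[Lsub_basis d]}.
Notation Lspace R d := {malg R[Lspace_basis d]}.

Section Products.
Context (R : comNzRingType) (d : nat).
Local Notation poly := {malg R[midx d]}.
Implicit Types (n : nvec d) (i : 'I_d.+1) (g b : midx d).

(* Set to 0 outside the basis; the coefficients of such terms below all vanish,
   by [dcoef_zD_op_mdegree] and [dcoef_dpart_mdegree]. *)
Definition zD g n : Lsub R d :=
  if insub g is Some g0 then << (g0, n) >> else 0.

Definition incl (x : Lsub R d) : Lspace R d :=
  \sum_(k <- msupp x) x@_k *: << inl k >>.

Definition act (T : poly -> poly) g n : Lsub R d :=
  \sum_(b \in [set: midx d]) dcoef T g b *: zD b n.

Lemma act_finite (T : poly -> poly) g n : finite_set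
  [set b | dcoef T g b *: zD b n != 0].
Proof.
apply: (sub_finite_set _ (finite_fset (msupp (T (zmon R g))))).
move=> b /= bnz; rewrite -mcoeff_neq0; apply: contraNneq bnz => b0.
by rewrite /dcoef b0 scale0r.
Qed.

Definition prelie : Lsub R d -> Lsub R d -> Lsub R d :=
  bilin_ext (fun '((g, n) : Lsub_basis d) '((g', n') : Lsub_basis d) =>
    act (zD_op (val g) n) (val g') n').

(* [n_i z^g D^(n - e_i)] *)
Definition lower g n i : Lsub R d := (n i)%:R *: zD g (sub_evec n i).

Definition lie_bracket : Lspace R d -> Lspace R d -> Lspace R d :=
  bilin_ext (fun u w : Lspace_basis d => match u, w with
    | inl (g, n), inl (g', n') =>
        incl (act (zD_op (val g) n) (val g') n' - act (zD_op (val g') n') (val g) n)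
    | inl (g, n), inr i => incl (lower (val g) n i - act (dpart i) (val g) n)
    | inr i, inl (g, n) => - incl (lower (val g) n i - act (dpart i) (val g) n)
    | inr _, inr _ => 0
    end).

Definition bracket0 : Lspace R d -> Lspace R d -> Lspace R d :=
  bilin_ext (fun u w : Lspace_basis d => match u, w with
    | inl (g, n), inr i => incl (lower (val g) n i)
    | inr i, inl (g, n) => - incl (lower (val g) n i)
    | inl _, inl _ | inr _, inr _ => 0
    end).

Definition hat_prelie : Lspace R d -> Lspace R d -> Lspace R d :=
  bilin_ext (fun u w : Lspace_basis d => match u, w with
    | inl p, inl q => incl (prelie << p >> << q >>)
    | inr i, inl (g, n) => incl (act (dpart i) (val g) n)
    | inl _, inr _ | inr _, inr _ => 0
    end).

Definition post_lie_bracket (x y : Lspace R d) : Lspace R d :=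
  bracket0 x y + hat_prelie x y - hat_prelie y x.

End Products.

(* Main.v *)
Require Import Defs.
From HB Require Import structures.
From mathcomp Require Import all_boot all_order all_algebra.
From mathcomp Require Import finmap ring.
From mathcomp Require Import boolp classical_sets fsbigop.
From mathcomp Require Import reals monalg.

Set Implicit Arguments.
Unset Strict Implicit.
Unset Printing Implicit Defensive.

Import Order.TTheory GRing.Theory Num.Theory.

Local Open Scope ring_scope.

(** Read an element [x] of [L] as a first-order differential operator with
    polynomial coefficients plus a constant vector: [x] is determined by the
    polynomials [part n x] multiplying the D^(n) and by the scalars [dir i x]
    multiplying the partial_i ([part_faithful]).  It acts on polynomials by a
    derivation [op x], and both operations of the theorem become simple formulas
    in these coordinates:
    - x |> y acts with [op x] on each [part n y] ([part_hat_prelie]);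
    - the bracket [x, y]_0 shifts the parts of [x] along the direction of [y],
      minus the same with [x] and [y] exchanged ([part_bracket0]), where
      shifting along c sends f to n |-> sum_i c_i (n_i + 1) f (n + e_i);
    - neither operation has a component along the partial_i.

    The shifts along two directions commute ([dshiftC]), which is the Jacobi
    identity of [., .]_0.  They commute with linear maps, in particular with
    [op x], which is the derivation axiom.

    The associator axiom says that x |-> [op x] turns the double bracket
    [[x, y]] = [x, y]_0 + x |> y - y |> x into the commutator of derivations
    ([op_dbr]).  Both sides are derivations, so this is only checked on the
    variables.  There [op x] is governed by [field x n], the total coefficient
    of D^(n) once the partial_i are expanded as sums over the D^(n): it sends
    z_n to [field x n] and z_k to [field x 0 * (k + 1) z_(k+1)].  Thus no
    infinite sum has to be composed with another one.  The same identity gives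
    the Jacobi identity of the double bracket, because [[x, y]] has no direction
    and so its parts are exactly its field, which obeys the commutator formula
    [field_dbr].

    Finally the double bracket and the original Lie bracket are bilinear and
    agree on pairs of basis elements ([post_lie_bracketE]). *)

(** * Linear and bilinear extension from a basis *)

(** Sealed, so that comparing two basis vectors compares their indices instead of
    unfolding finitely supported functions. *)

HB.lock Definition basis (R : comNzRingType) (K : choiceType) (k : K) : {malg R[K]} :=
  << k >>.

Section LinearExtension.
Context (R : comNzRingType).
Local Notation basis := (basis R).

Lemma basisE (K : choiceType) (k : K) : << k >> = basis k.
Proof. by rewrite basis.unlock. Qed.

Lemma mcoeff_basis (K : choiceType) (k k' : K) : (basis k)@_k' = (k == k')%:R.
Proof. by rewrite basis.unlock mcoeffU. Qed.

Lemma malgU_basis (K : choiceType) (c : R) (k : K) :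
  << c *g k >> = c *: basis k.
Proof. by apply/malgP => k'; rewrite mcoeffZ mcoeffU mcoeff_basis mulr_natr. Qed.

Lemma linear_malg_eq (K : choiceType) (V : lmodType R) (f g : {malg R[K]} -> V) :
  linear f -> linear g -> (forall k, f (basis k) = g (basis k)) -> f =1 g.
Proof.
move=> lf lg fg x.
pose F : {linear {malg R[K]} -> V} := HB.pack f
  (GRing.isLinear.Build _ _ _ _ f lf).
pose G : {linear {malg R[K]} -> V} := HB.pack g
  (GRing.isLinear.Build _ _ _ _ g lg).
rewrite -[f]/(F : _ -> _) -[g]/(G : _ -> _) (monalgE x) !linear_sum.
by apply: eq_bigr => k _; rewrite malgU_basis !linearZ /= fg.
Qed.

Lemma bilinear_malg_eq (J K : choiceType) (V : lmodType R)
    (f g : {malg R[J]} -> {malg R[K]} -> V) :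
  bilinear_for *:%R *:%R f -> bilinear_for *:%R *:%R g ->
  (forall j k, f (basis j) (basis k) = g (basis j) (basis k)) -> forall x y, f x y = g x y.
Proof.
move=> [fl fr] [gl gr] fg x y.
apply: (linear_malg_eq (fl y) (gl y)) => j.
by apply: (linear_malg_eq (fr _) (gr _)) => k.
Qed.

Lemma bilinear0 (U U' V : lmodType R) :
  bilinear_for *:%R *:%R (fun (_ : U) (_ : U') => 0 : V).
Proof. by split=> u a v w /=; rewrite scaler0 addr0. Qed.

Lemma bilinear_comp (U U' V W : lmodType R) (b : U -> U' -> V) (T : V -> W) :
  linear T -> bilinear_for *:%R *:%R b ->
  bilinear_for *:%R *:%R (fun x y => T (b x y)).
Proof. by move=> Tl [bl br]; split=> u a v w; rewrite ?bl ?br Tl. Qed.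

Lemma bilinear_skew (U V : lmodType R) (b : U -> U -> V) :
  bilinear_for *:%R *:%R b -> bilinear_for *:%R *:%R (fun x y => b x y - b y x).
Proof.
by move=> [bl br]; split=> u a v w /=; rewrite bl br scalerBr opprD addrACA.
Qed.

Definition lin_ext (K : choiceType) (V : lmodType R) (f : K -> V)
  (x : {malg R[K]}) : V := \sum_(k <- msupp x) x@_k *: f k.

Lemma lin_extEw (K : choiceType) (V : lmodType R) (f : K -> V) x (X : {fset K}) :
  (msupp x `<=` X)%fset -> lin_ext f x = \sum_(k <- X) x@_k *: f k.
Proof.
move=> xX; apply: big_fset_incl => // k _ /mcoeff_outdom ->.
by rewrite scale0r.
Qed.

Lemma lin_ext_linear (K : choiceType) (V : lmodType R) (f : K -> V) :
  linear (lin_ext f).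
Proof.
move=> a x y; set X := (msupp x `|` msupp y)%fset.
have xX : (msupp x `<=` X)%fset by apply: fsubsetUl.
have yX : (msupp y `<=` X)%fset by apply: fsubsetUr.
have axyX : (msupp (a *: x + y) `<=` X)%fset.
  apply: (fsubset_trans (msuppD_le _ _)).
  by rewrite fsetSU // msuppZ_le.
rewrite (lin_extEw _ xX) (lin_extEw _ yX) (lin_extEw _ axyX).
rewrite scaler_sumr -big_split; apply: eq_bigr => k _ /=.
by rewrite mcoeffD mcoeffZ scalerDl scalerA.
Qed.

HB.instance Definition _ (K : choiceType) (V : lmodType R) (f : K -> V) :=
  GRing.isLinear.Build R {malg R[K]} V *:%R (lin_ext f) (lin_ext_linear f).

Lemma lin_ext_basis (K : choiceType) (V : lmodType R) (f : K -> V) k :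
  lin_ext f (basis k) = f k.
Proof. by rewrite /lin_ext basis.unlock msuppU oner_eq0 big_seq_fset1 mcoeffUU scale1r. Qed.

Lemma linear_lin_ext (K : choiceType) (U V : lmodType R) (f : K -> U) (T : U -> V) x :
  linear T -> T (lin_ext f x) = lin_ext (T \o f) x.
Proof.
move=> Tl; move: x; apply: linear_malg_eq => [a x y|a x y|k].
- by rewrite linearP Tl.
- by rewrite linearP.
by rewrite !lin_ext_basis.
Qed.

Lemma lin_ext_id (K : choiceType) (x : {malg R[K]}) : lin_ext (@basis K) x = x.
Proof. by rewrite [RHS]monalgE; apply: eq_bigr => k _; rewrite malgU_basis. Qed.

Lemma eq_lin_ext (K : choiceType) (V : lmodType R) (f g : K -> V) (x : {malg R[K]}) :
  (forall k, x@_k != 0 -> f k = g k) -> lin_ext f x = lin_ext g x.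
Proof.
move=> fg; apply: eq_big_seq => k kx.
by rewrite fg // mcoeff_neq0.
Qed.

Lemma lin_ext_param (K : choiceType) (U V : lmodType R) (F : K -> U -> V) x :
  (forall k, linear (F k)) -> linear (fun u => lin_ext (F^~ u) x).
Proof.
move=> Fl a u v; rewrite /lin_ext scaler_sumr -big_split.
apply: eq_bigr => k _ /=.
by rewrite Fl scalerDr !scalerA mulrC.
Qed.

Section Bilinear.
Context (J K : choiceType) (V : lmodType R) (b : J -> K -> V).

Lemma bilin_extE x y : bilin_ext b x y = lin_ext (fun j => lin_ext (b j) y) x.
Proof.
apply: eq_bigr => j _; rewrite scaler_sumr; apply: eq_bigr => k _.
by rewrite scalerA.
Qed.

Lemma bilin_ext_bilinear : bilinear_for *:%R *:%R (bilin_ext b).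
Proof.
split=> [y|x] a u v; rewrite !bilin_extE ?linearP //.
exact: (lin_ext_param x (fun j => lin_ext_linear (b j))).
Qed.

HB.instance Definition _ := bilinear_isBilinear.Build R {malg R[J]} {malg R[K]}
  V *:%R *:%R (bilin_ext b) bilin_ext_bilinear.

Lemma bilin_ext_basis j k : bilin_ext b (basis j) (basis k) = b j k.
Proof. by rewrite bilin_extE !lin_ext_basis. Qed.

End Bilinear.
End LinearExtension.

(** * Derivations of a commutative algebra *)

Section Derivations.
Context (R : comNzRingType) (A : comAlgType R).
Implicit Types (T S : A -> A) (a b : A).

Record derivation T : Prop := Derivation {
  der_linear : linear T;
  der_leibniz : forall a b, T (a * b) = T a * b + a * T b
}.

Lemma derB T : derivation T -> {morph T : a b / a - b}.
Proof. by move=> [Tl _] a b; rewrite (zmod_morphism_linear Tl). Qed.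

Lemma derD T : derivation T -> {morph T : a b / a + b}.
Proof. by move=> [Tl _] a b; have := Tl 1 a b; rewrite !scale1r. Qed.

Lemma derZ T : derivation T -> forall c, {morph T : a / c *: a}.
Proof. by move=> [Tl _]; exact: (scalable_linear Tl). Qed.

Lemma der0 T : derivation T -> T 0 = 0.
Proof. by move=> TD; have := derB TD 0 0; rewrite !subrr. Qed.

Lemma der1 T : derivation T -> T 1 = 0.
Proof.
move=> [_ /(_ 1 1)]; rewrite !mulr1 mul1r => T1.
by apply: (addIr (T 1)); rewrite -T1 add0r.
Qed.

Lemma der_mull a T : derivation T -> derivation (fun b => a * T b).
Proof.
move=> TD; split=> [c b b'|b b']; first by rewrite (der_linear TD) mulrDr -scalerAr.
by rewrite (der_leibniz TD); ring.
Qed.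

Lemma der_scale c T : derivation T -> derivation (fun b => c *: T b).
Proof.
move=> /(der_mull (c%:A)) TD; rewrite (_ : (fun b => _) = (fun b => c%:A * T b)) //.
by apply/funext => b; rewrite mulr_algl.
Qed.

Lemma der_sum (I : Type) (r : seq I) (F : I -> A -> A) :
  (forall i, derivation (F i)) -> derivation (fun a => \sum_(i <- r) F i a).
Proof.
move=> FD; split=> [c a b|a b].
  rewrite scaler_sumr -big_split; apply: eq_bigr => i _.
  exact: der_linear.
rewrite mulr_suml mulr_sumr -big_split; apply: eq_bigr => i _.
exact: der_leibniz.
Qed.

(** The identities involve at most three arguments at a time, and on those the
    sum may be taken over a common finite index set. *)
Lemma der_fsum (I : choiceType) (F : I -> A -> A) :
  (forall i, derivation (F i)) ->
  (forall a, exists X : {fset I}, forall i, i \notin X -> F i a = 0) ->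
  derivation (fun a => \sum_(i \in [set: I]) F i a).
Proof.
move=> FD Ffin.
have common a b c : exists X : {fset I},
    {in [:: a; b; c], forall a, \sum_(i \in [set: I]) F i a = \sum_(i <- X) F i a}.
  have [[X Xa] [Y Yb] [Z Zc]] := And3 (Ffin a) (Ffin b) (Ffin c).
  exists (X `|` Y `|` Z)%fset => w; rewrite !inE => wabc.
  apply: fsbigTE => i; rewrite !inE => /norP[/norP[iX iY] iZ].
  by case/or3P: wabc => /eqP ->; [exact: Xa | exact: Yb | exact: Zc].
split=> [c a b|a b].
  have [X XE] := common a b (c *: a + b).
  by rewrite !XE ?inE ?eqxx ?orbT //; exact: (der_linear (der_sum X FD)).
have [X XE] := common a b (a * b).
by rewrite !XE ?inE ?eqxx ?orbT //; exact: (der_leibniz (der_sum X FD)).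
Qed.

Lemma der_comm S T : derivation S -> derivation T ->
  derivation (fun a => S (T a) - T (S a)).
Proof.
move=> SD TD; split=> [c a b|a b].
  rewrite !(der_linear SD, der_linear TD) scalerBr.
  by rewrite opprD addrACA.
rewrite !(der_leibniz SD, der_leibniz TD, derD SD, derD TD).
by ring.
Qed.

End Derivations.

Section MonomialLeibniz.
Context (R : comNzRingType) (A : comAlgType R) (M : Type) (mon : M -> A).
Hypothesis mon_ext : forall f g : A -> A, linear f -> linear g ->
  (forall m, f (mon m) = g (mon m)) -> f =1 g.

Lemma derivation_mon (D : A -> A) : linear D ->
  (forall m m', D (mon m * mon m') = D (mon m) * mon m' + mon m * D (mon m')) ->
  derivation D.
Proof.
move=> Dl Dmon; split=> // a b.
move: a; apply: mon_ext => [c a a'|c a a'|m].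
- by rewrite mulrDl -scalerAl Dl.
- by rewrite Dl !mulrDl -!scalerAl scalerDr addrACA.
move: b; apply: mon_ext => [c a a'|c a a'|//].
- by rewrite mulrDr -scalerAr Dl.
by rewrite Dl !mulrDr -!scalerAr scalerDr addrACA.
Qed.

End MonomialLeibniz.

Section PartialLeibniz.
Context (R : comNzRingType) (A : comAlgType R) (I : choiceType).
Context (mon : {cmonom I} -> A) (D : A -> A) (v : I).
Hypothesis monM : forall g h, mon (mmul g h) = mon g * mon h.
Hypothesis D_mon : forall g, D (mon g) = (g v)%:R *: mon (divcm g (ucm v)).

(** The exponent of [v] is additive, and when it vanishes in a factor the
    truncated quotient [divcm] of that factor is multiplied by 0. *)
Lemma partial_leibniz g h : D (mon g * mon h) = D (mon g) * mon h + mon g * D (mon h).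
Proof.
have half (g' h' : {cmonom I}) :
    (g' v)%:R *: mon (divcm (mmul g' h') (ucm v)) = D (mon g') * mon h'.
  rewrite D_mon; have [->|g'v] := eqVneq (g' v) 0%N; first by rewrite !scale0r mul0r.
  rewrite -scalerAl -monM; congr (_ *: mon _); apply/eqP/cmP => w.
  rewrite !(cmM, divcmE) cmU addnBAC //.
  by case: eqVneq => [<-|//]; rewrite lt0n.
by rewrite -monM D_mon cmM natrD scalerDl half [mon g * _]mulrC -(half h g) (mulmC h g).
Qed.

End PartialLeibniz.

(** * Derivations of a polynomial algebra *)

Section PolynomialDerivations.
Context (R : comNzRingType) (I : choiceType).
Local Notation poly := {malg R[{cmonom I}]}.

Lemma basisM (g h : {cmonom I}) : basis R (mmul g h) = basis R g * basis R h.
Proof. by rewrite malgM_def basis.unlock fgmulUU mulr1. Qed.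

Lemma basis1 : basis R (mone : {cmonom I}) = 1.
Proof. by rewrite basis.unlock. Qed.

Lemma cmonom_ind (P : {cmonom I} -> Prop) :
  P mone -> (forall v g, P g -> P (mmul (ucm v) g)) -> forall g, P g.
Proof.
move=> P1 PU g; have [n] := ubnP (mdeg g).
elim: n g => // n IHn g; rewrite ltnS => gn.
have [->//|] := eqVneq g mone.
rewrite -mdeg_eq0 mdegE => g0.
have /fset0Pn[v] : finsupp g != fset0.
  by apply: contraNneq g0 => ->; rewrite big_seq_fset0.
rewrite -cmE_neq0 => vg.
have gE : g = mmul (ucm v) (divcm g (ucm v)).
  apply/eqP/cmP => w; rewrite cmM divcmE subnKC // cmU.
  by case: eqVneq => [<-|//]; rewrite lt0n.
rewrite gE; apply: PU; apply: IHn; move: gn.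
by rewrite {1}gE mdegM mdegU.
Qed.

Lemma derivation_eq (S T : poly -> poly) : derivation S -> derivation T ->
  (forall v, S (basis R (ucm v)) = T (basis R (ucm v))) -> S =1 T.
Proof.
move=> SD TD ST; apply: (linear_malg_eq (der_linear SD) (der_linear TD)).
elim/cmonom_ind => [|v g IHg].
  by rewrite basis1 !der1.
by rewrite basisM (der_leibniz SD) (der_leibniz TD) ST IHg.
Qed.

End PolynomialDerivations.

(** * The operators D^(n) and partial_i *)

Section PartialDerivatives.
Context (R : comNzRingType) (d : nat).
Local Notation poly := {malg R[midx d]}.
Implicit Types (P Q : poly) (n : nvec d) (i : 'I_d.+1) (g h : midx d) (v : zindex d).

Local Notation zvar v := (basis R (ucm (v : zindex d))).

Lemma zmonE g : zmon R g = basis R g. Proof. exact: basisE. Qed.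

Lemma pderivE v P :
  pderiv v P = lin_ext (fun g => (g v)%:R *: basis R (divcm g (ucm v))) P.
Proof. by apply: eq_bigr => g _; rewrite zmonE scalerA. Qed.

Local Opaque pderiv.

Lemma pderiv_basis v g :
  pderiv v (basis R g) = (g v)%:R *: basis R (divcm g (ucm v)).
Proof. by rewrite pderivE lin_ext_basis. Qed.

Lemma pderiv_der v : derivation (@pderiv R d v).
Proof.
apply: (derivation_mon (@linear_malg_eq R _ _)).
  by move=> a P Q; rewrite !pderivE linearP.
exact: (partial_leibniz (@basisM R _) (pderiv_basis v)).
Qed.

Lemma D0_der : derivation (@D0 R d).
Proof.
apply: der_fsum => [k|P]; first exact/der_scale/der_mull/pderiv_der.
have [X XP] := pderiv_finite P.
exists [fset k in pmap (fun v : zindex d => if v is inl k then Some k else None) X]%fset.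
move=> k; rewrite inE mem_pmap => kX.
rewrite XP ?mulr0 ?scaler0 //; apply: contra kX => kX.
by apply/mapP; exists (inl k).
Qed.

Lemma Dn_der n : derivation (@Dn R d n).
Proof. by rewrite /Dn; case: insub => [m|]; [exact: pderiv_der | exact: D0_der]. Qed.

Lemma dpart_der i : derivation (@dpart R d i).
Proof.
apply: der_fsum => [n|P]; first exact/der_scale/der_mull/Dn_der.
have [X XP] := pderiv_finite P.
exists [fset n in (0 : nvec d) :: pmap
  (fun v : zindex d => if v is inr m then Some (val m) else None) X]%fset.
move=> n; rewrite !inE negb_or => /andP[n0]; rewrite mem_pmap => nX.
rewrite /Dn insubT XP ?mulr0 ?scaler0 //; apply: contra nX => nX.
by apply/mapP; exists (inr (Sub n n0)).
Qed.

Lemma pderiv_var v w : pderiv v (zvar w) = (v == w)%:R.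
Proof.
rewrite pderiv_basis cmU eq_sym; case: eqVneq => [->|_]; last by rewrite scale0r.
have -> : divcm (ucm w) (ucm w) = mone.
  by apply/eqP/cmP => u; rewrite divcmE cm1 subnn.
by rewrite basis1 scale1r.
Qed.

Lemma D0_zk k : D0 (zvar (inl k)) = k.+1%:R *: zvar (inl k.+1).
Proof.
rewrite /D0 (@fsbigTE _ _ _ _ [fset k]%fset) => [|j].
  by rewrite big_seq_fset1 pderiv_var eqxx mulr1 /zk zmonE.
rewrite inE => jk; rewrite pderiv_var (_ : inl j == inl k = false) ?mulr0 ?scaler0 //.
exact: negbTE.
Qed.

Lemma D0_zn m : D0 (zvar (inr m)) = 0.
Proof. by apply: fsbig1 => k _; rewrite pderiv_var mulr0 scaler0. Qed.

Lemma Dn_zk n k :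
  Dn n (zvar (inl k)) = (n == 0)%:R * (k.+1%:R *: zvar (inl k.+1)).
Proof.
rewrite /Dn; case: insubP => [m n0 _|]; first by rewrite pderiv_var (negbTE n0) mul0r.
by rewrite negbK => ->; rewrite mul1r D0_zk.
Qed.

Lemma Dn_zn n m : Dn n (zvar (inr m)) = (n == val m)%:R.
Proof.
rewrite /Dn; case: insubP => [m' n0 <-|]; first by rewrite pderiv_var.
rewrite negbK => /eqP ->; rewrite D0_zn.
by rewrite eq_sym (negbTE (valP m)).
Qed.

(** The variable z_n as a total function of n.  The value at 0 is never reached,
    the indices that occur having the form [n + evec i]. *)
Definition znvar n : poly := if insub n is Some m then zvar (inr m) else 0.

Lemma znvar_add n i :
  zn R (Sub (n + evec i) (add_evec_neq0 n i)) = znvar (n + evec i).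
Proof.
rewrite /znvar (insubT (fun n : nvec d => n != 0) (add_evec_neq0 n i)).
by rewrite /zn zmonE.
Qed.

(** A variable is killed by all the D^(m) but one, and this evaluates the
    infinite sum defining partial_i. *)
Lemma dpartE i P n : (forall m, m != n -> Dn m P = 0) ->
  dpart i P = (n i).+1%:R *: (znvar (n + evec i) * Dn n P).
Proof.
move=> Pn; rewrite /dpart (@fsbigTE _ _ _ _ [fset n]%fset) => [|m].
  by rewrite big_seq_fset1 znvar_add.
by rewrite inE => /Pn ->; rewrite mulr0 scaler0.
Qed.

Lemma dpart_zk i k : dpart i (zvar (inl k)) =
  znvar (0 + evec i) * (k.+1%:R *: zvar (inl k.+1)).
Proof.
rewrite (@dpartE _ _ 0) => [|m m0]; last by rewrite Dn_zk (negbTE m0) mul0r.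
by rewrite Dn_zk eqxx mul1r ffunE scale1r.
Qed.

Lemma dpart_zn i m :
  dpart i (zvar (inr m)) = (val m i).+1%:R *: znvar (val m + evec i).
Proof.
rewrite (@dpartE _ _ (val m)) => [|n nm]; last by rewrite Dn_zn (negbTE nm).
by rewrite Dn_zn eqxx mulr1.
Qed.

End PartialDerivatives.

(** * Shifting a family of polynomials along a direction *)

Section Shift.
Context (R : comNzRingType) (d : nat) (V : lmodType R).
Implicit Types (c : 'I_d.+1 -> R) (f : nvec d -> V) (n : nvec d).

(** If f lists the coefficients of x in the D^(n), this lists the coefficients of
    [x, sum_i c_i partial_i]_0: the factor n_i of D^(n - e_i) is m_i + 1 in terms
    of its index m = n - e_i. *)
Definition dshift c f n : V := \sum_i (c i * (n i).+1%:R) *: f (n + evec i).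

Lemma eq_dshift c f f' n : f =1 f' -> dshift c f n = dshift c f' n.
Proof. by move=> ff'; apply: eq_bigr => i _; rewrite ff'. Qed.

Lemma dshift0 c f n : c =1 (fun=> 0) -> dshift c f n = 0.
Proof. by move=> c0; apply: big1 => i _; rewrite c0 mul0r scale0r. Qed.

Lemma dshiftP c a f f' n :
  dshift c (fun m => a *: f m + f' m) n = a *: dshift c f n + dshift c f' n.
Proof.
rewrite scaler_sumr -big_split; apply: eq_bigr => i _ /=.
by rewrite scalerDr !scalerA [a * _]mulrC.
Qed.

Lemma dshiftPl c c' a f n :
  dshift (fun i => a * c i + c' i) f n = a *: dshift c f n + dshift c' f n.
Proof.
rewrite scaler_sumr -big_split; apply: eq_bigr => i _ /=.
by rewrite mulrDl scalerDl scalerA mulrA.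
Qed.

Lemma dshiftD c f f' n :
  dshift c (fun m => f m + f' m) n = dshift c f n + dshift c f' n.
Proof.
rewrite -[dshift c f n]scale1r -dshiftP.
by apply: eq_dshift => m; rewrite scale1r.
Qed.

Lemma dshiftB c f f' n :
  dshift c (fun m => f m - f' m) n = dshift c f n - dshift c f' n.
Proof.
rewrite [RHS]addrC -scaleN1r -dshiftP.
by apply: eq_dshift => m; rewrite scaleN1r addrC.
Qed.

Lemma dshift_delta i f n :
  dshift (fun j => (i == j)%:R) f n = (n i).+1%:R *: f (n + evec i).
Proof.
rewrite /dshift (bigD1 i) //= eqxx mul1r big1 ?addr0 // => j.
by rewrite eq_sym => /negPf ->; rewrite mul0r scale0r.
Qed.

(** The coefficient of f (n + e_i + e_j) is (n_i + 1) (n_j + 1 + delta_ij), which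
    is symmetric in i and j. *)
Lemma dshiftC c c' f n : dshift c (dshift c' f) n = dshift c' (dshift c f) n.
Proof.
have E c1 c2 : dshift c1 (dshift c2 f) n = \sum_i \sum_j
   (c1 i * c2 j * ((n i).+1 * (n j + (i == j)).+1)%:R) *: f (n + evec i + evec j).
  apply: eq_bigr => i _; rewrite scaler_sumr; apply: eq_bigr => j _.
  rewrite scalerA natrM !ffunE; congr (_ *: _); ring.
rewrite !E exchange_big; apply: eq_bigr => i _; apply: eq_bigr => j _.
rewrite addrAC [c j * _]mulrC; congr (_ * _%:R *: _).
rewrite [j == i]eq_sym; case: eqVneq => [->//|_].
by rewrite !addn0 mulnC.
Qed.

End Shift.

Lemma linear_dshift (R : comNzRingType) (d : nat) (U V : lmodType R)
    (T : U -> V) (c : 'I_d.+1 -> R) (f : nvec d -> U) n : linear T ->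
  T (dshift c f n) = dshift c (T \o f) n.
Proof.
move=> Tl; rewrite /dshift.
pose F : {linear U -> V} := HB.pack T (GRing.isLinear.Build _ _ _ _ T Tl).
rewrite -[T]/(F : _ -> _) linear_sum; apply: eq_bigr => i _.
by rewrite linearZ.
Qed.

(** * Post-Lie algebras of derivations with directions *)

(** The axioms satisfied by the coordinates of [L]; [op x] is a derivation of [A]
    that is determined by its values on the generators [znat k], [zvec n]. *)
Section Model.
Context (R : comNzRingType) (d : nat) (A : comAlgType R) (L : lmodType R).
Context (part : nvec d -> L -> A) (dir : 'I_d.+1 -> L -> R) (op : L -> A -> A).
Context (znat : nat -> A) (zvec : nvec d -> A).
Context (br tri : L -> L -> L).
Implicit Types (x y z : L) (n : nvec d) (P : A).

Local Notation sh x f := (dshift (fun i => dir i x) f).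

(** The coefficient of D^(n) in [op x], the partial_i being expanded. *)
Definition field x n : A := part n x + sh x zvec n.

Hypothesis part_linear : forall n, linear (part n).
Hypothesis op_linear : forall P, linear (op^~ P).
Hypothesis faithful : forall x y,
  (forall n, part n x = part n y) -> (forall i, dir i x = dir i y) -> x = y.
Hypothesis dir_linear : forall i, linear_for *%R (dir i).

Hypothesis op_der : forall x, derivation (op x).
Hypothesis der_ext : forall S T : A -> A, derivation S -> derivation T ->
  (forall k, S (znat k) = T (znat k)) ->
  (forall n, n != 0 -> S (zvec n) = T (zvec n)) -> S =1 T.
Hypothesis op_znat : forall x k, op x (znat k) = field x 0 * (k.+1%:R *: znat k.+1).
Hypothesis op_zvec : forall x n, n != 0 -> op x (zvec n) = field x n.

Hypothesis br_bilinear : bilinear_for *:%R *:%R br.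
Hypothesis tri_bilinear : bilinear_for *:%R *:%R tri.
Hypothesis part_br : forall x y n,
  part n (br x y) = sh y (part^~ x) n - sh x (part^~ y) n.
Hypothesis dir_br : forall x y i, dir i (br x y) = 0.
Hypothesis part_tri : forall x y n, part n (tri x y) = op x (part n y).
Hypothesis dir_tri : forall x y i, dir i (tri x y) = 0.

Definition dbr x y : L := br x y + tri x y - tri y x.

Lemma part0 n : part n 0 = 0.
Proof. by have := zmod_morphism_linear (part_linear n) 0 0; rewrite !subrr. Qed.

Lemma partB n : {morph part n : x y / x - y}.
Proof. exact: (zmod_morphism_linear (part_linear n)). Qed.

Lemma partD n : {morph part n : x y / x + y}.
Proof. by move=> x y; have := part_linear n 1 x y; rewrite !scale1r. Qed.

Lemma dirB i : {morph dir i : x y / x - y}.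
Proof. by move=> x y; rewrite addrC -scaleN1r dir_linear mulN1r addrC. Qed.

Lemma dirD i : {morph dir i : x y / x + y}.
Proof. by move=> x y; have := dir_linear i 1 x y; rewrite scale1r mul1r. Qed.

Lemma dir0 i : dir i 0 = 0.
Proof. by rewrite -(subrr 0) dirB subrr. Qed.

Lemma opDl P : {morph op^~ P : x y / x + y}.
Proof. by move=> x y; have := op_linear P 1 x y; rewrite !scale1r. Qed.

Lemma opBl P : {morph op^~ P : x y / x - y}.
Proof. exact: (zmod_morphism_linear (op_linear P)). Qed.

Lemma field_linear n : linear (field^~ n).
Proof.
move=> a x y; rewrite /field part_linear scalerDr addrACA -dshiftPl.
by congr (_ + _); apply: eq_bigr => i _; rewrite dir_linear.
Qed.

Lemma op_sh_zvec x y n : op x (sh y zvec n) = sh y (field x) n.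
Proof.
rewrite (linear_dshift _ _ _ (der_linear (op_der x))).
by apply: eq_bigr => i _; rewrite /= op_zvec // add_evec_neq0.
Qed.

Lemma dir_dbr x y i : dir i (dbr x y) = 0.
Proof. by rewrite dirB dirD dir_br !dir_tri addr0 subr0. Qed.

(** The double shifts of the variables coming from the two directions cancel by
    [dshiftC]; what remains is the definition of the double bracket. *)
Lemma field_dbr x y n : field (dbr x y) n = op x (field y n) - op y (field x n).
Proof.
rewrite /field (dshift0 (c := fun i => dir i _)) => [|i]; last exact: dir_dbr.
rewrite addr0 !(derD (op_der _)) !op_sh_zvec partB partD part_br !part_tri.
rewrite /field !dshiftD [sh y (sh x _) n]dshiftC.
ring.
Qed.

(** On [znat k] the extra terms of the commutator are
    [field x 0 * field y 0 * (k + 1) (k + 2) z_(k+2)], symmetric in [x] and [y]: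
    this is the commutation of D^(0) with itself. *)
Lemma op_dbr x y P : op (dbr x y) P = op x (op y P) - op y (op x P).
Proof.
move: P; apply: (der_ext (op_der _) (der_comm (op_der _) (op_der _))) => [k|n n0].
  rewrite !op_znat !(der_leibniz (op_der _)) !(derZ (op_der _)) !op_znat field_dbr.
  by rewrite !scalerAr; ring.
by rewrite !op_zvec // field_dbr.
Qed.

Lemma br_lie : is_lie_bracket br.
Proof.
split=> // [x|x y z]; apply: faithful => [n|i].
- by rewrite part_br subrr part0.
- by rewrite dir_br dir0.
- have inner a b c m : part m (br a (br b c)) =
      sh a (sh b (part^~ c)) m - sh a (sh c (part^~ b)) m.
    rewrite part_br (dshift0 (c := fun i => dir i (br b c))) => [|i]; last exact: dir_br.
    rewrite sub0r (@eq_dshift _ _ _ _ _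
      (fun m => sh c (part^~ b) m - sh b (part^~ c) m)) => [|p]; last exact: part_br.
    by rewrite dshiftB opprB.
  rewrite !partD !inner part0.
  rewrite (dshiftC _ _ (part^~ z)) (dshiftC _ _ (part^~ x)) (dshiftC _ _ (part^~ y)).
  ring.
- by rewrite !dirD !dir_br !addr0 dir0.
Qed.

Lemma br_tri_post_lie : is_post_lie br tri.
Proof.
split=> // [|x y z|x y z]; first exact: br_lie.
  apply: faithful => [n|i]; last by rewrite dirD !dir_br dir_tri addr0.
  rewrite partD !(part_tri, part_br).
  rewrite (dshift0 (c := fun i => dir i (tri x y))) => [|i]; last exact: dir_tri.
  rewrite (dshift0 (c := fun i => dir i (tri x z))) => [|i]; last exact: dir_tri.
  rewrite subr0 sub0r (derB (op_der x)) !(linear_dshift _ _ _ (der_linear (op_der x))).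
  congr (_ - _); apply: eq_dshift => m /=; exact/esym/part_tri.
apply: faithful => [n|i]; last by rewrite /associator !dirB !dir_tri !subrr.
rewrite /associator !partB !part_tri.
have := op_dbr x y (part n z); rewrite opBl opDl => E.
apply: (addIr (op (tri x y) (part n z) - op (tri y x) (part n z))).
rewrite addrA E; ring.
Qed.

Lemma dbr_bilinear : bilinear_for *:%R *:%R dbr.
Proof.
have [[brl brr] [tril trir]] := (br_bilinear, tri_bilinear).
have comb a (u v u' v' u'' v'' : L) :
    (a *: u + v) + (a *: u' + v') - (a *: u'' + v'') =
    a *: (u + u' - u'') + (v + v' - v'').
  by rewrite addrACA -scalerDr opprD addrACA -scalerBr.
split=> [y|x] a u v; rewrite /dbr.
  by rewrite (brl y) (tril y) (trir y) comb.
by rewrite (brr x) (trir x) (tril x) comb.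
Qed.

Lemma part_dbr x y n : part n (dbr x y) = field (dbr x y) n.
Proof. by rewrite /field dshift0 ?addr0 // => i; rewrite dir_dbr. Qed.

(** [[x, y]] has no direction, so its parts are its field; hence the identity
    reduces to the Jacobi identity for commutators applied to the fields. *)
Lemma dbr_lie : is_lie_bracket dbr.
Proof.
split=> [|x|x y z]; first exact: dbr_bilinear.
  rewrite /dbr addrK; exact: (lie_alternating br_lie).
apply: faithful => [n|i]; last by rewrite 2!dirD !dir_dbr !addr0 dir0.
have inner a b c : part n (dbr a (dbr b c)) =
    op a (op b (field c n)) - op a (op c (field b n))
    - (op b (op c (field a n)) - op c (op b (field a n))).
  by rewrite part_dbr !field_dbr op_dbr (derB (op_der a)).
by rewrite 2!partD !inner part0; ring.
Qed.

Lemma model_post_lie : is_post_lie br tri /\ is_lie_bracket dbr.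
Proof. by split; [exact: br_tri_post_lie | exact: dbr_lie]. Qed.

End Model.

Lemma mul_if_natr (A : comPzRingType) (b : bool) (p q : A) :
  p * (b%:R * q) = (if b then p else 0) * q.
Proof. by case: b; rewrite ?mul1r // !mul0r mulr0. Qed.

(** * The coordinates of the space L *)

Section Concrete.
Context (R : comNzRingType) (d : nat).
Local Notation poly := {malg R[midx d]}.
Local Notation L := (Lspace R d).
Implicit Types (g b : midx d) (n m : nvec d) (i : 'I_d.+1) (x y z : L) (P Q : poly).
Implicit Types (k l : Lspace_basis d).

Definition part_basis n k : poly :=
  if k is inl (g, m) then if m == n then basis R (val g) else 0 else 0.

Definition part n : L -> poly := lin_ext (part_basis n).

Definition dir i x : R := x@_(inr i).

Definition op_basis k P : poly :=
  match k with
  | inl (g, n) => basis R (val g) * Dn n P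
  | inr i => dpart i P
  end.

Definition op x P : poly := lin_ext (op_basis^~ P) x.

Lemma part_linear n : linear (part n). Proof. exact: lin_ext_linear. Qed.
Lemma op_linear P : linear (op^~ P). Proof. exact: lin_ext_linear. Qed.
Lemma dir_linear i : linear_for *%R (dir i).
Proof. by move=> a x y; rewrite /dir mcoeffD mcoeffZ. Qed.

Lemma op_basis_der k : derivation (op_basis k).
Proof.
by case: k => [[g n]|i] /=; [exact/der_mull/Dn_der | exact: dpart_der].
Qed.

Lemma op_der x : derivation (op x).
Proof. by apply: der_sum => k; apply/der_scale/op_basis_der. Qed.

Lemma part_faithful x y :
  (forall n, part n x = part n y) -> (forall i, dir i x = dir i y) -> x = y.
Proof.
have partE z (g : pidx d) n : (part n z)@_(val g) = z@_(inl (g, n)).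
  move: z; apply: (@linear_malg_eq R _ R^o) => [a u v|a u v|k].
  - by rewrite part_linear mcoeffD mcoeffZ.
  - by rewrite mcoeffD mcoeffZ.
  rewrite /part lin_ext_basis mcoeff_basis; case: k => [[h m]|i] /=; last first.
    by rewrite mcoeff0.
  rewrite (_ : inl (h, m) == inl (g, n) = (h == g) && (m == n)) //.
  case: (m == n); last by rewrite mcoeff0 andbF.
  by rewrite mcoeff_basis val_eqE andbT.
move=> xy dxy; apply/malgP => -[[g n]|i]; last exact: dxy.
by rewrite -!partE xy.
Qed.

Local Notation zvar v := (basis R (ucm (v : zindex d))).
Local Notation field := (field part dir (@znvar R d)).

Lemma field_basis n k : field (basis R k) n =
  match k with
  | inl (g, m) => if m == n then basis R (val g) else 0
  | inr i => (n i).+1%:R *: znvar R (n + evec i)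
  end.
Proof.
rewrite /field /part lin_ext_basis; case: k => [[g m]|i] /=.
  by rewrite dshift0 ?addr0 // => i; rewrite /dir mcoeff_basis.
rewrite add0r -dshift_delta; apply: eq_bigr => j _.
by rewrite /dir mcoeff_basis.
Qed.

Lemma op_zk x (k : nat) : op x (zvar (inl k)) =
  field x 0 * (k.+1%:R *: zvar (inl k.+1)).
Proof.
move: x; apply: linear_malg_eq => [|a x y|l]; first exact: op_linear.
  by rewrite (field_linear _ part_linear dir_linear) mulrDl scalerAl.
rewrite field_basis /op lin_ext_basis; case: l => [[g m]|i] /=.
  by rewrite Dn_zk mul_if_natr.
by rewrite dpart_zk ffunE scale1r.
Qed.

Lemma op_zn x n : n != 0 -> op x (znvar R n) = field x n.
Proof.
move=> n0; rewrite /znvar (insubT (fun n : nvec d => n != 0) n0).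
move: x; apply: linear_malg_eq => [||l]; first exact: op_linear.
  exact: (field_linear _ part_linear dir_linear).
rewrite field_basis /op lin_ext_basis; case: l => [[g m]|i] /=.
  by rewrite Dn_zn /=; case: (m == n); rewrite ?mulr1 ?mulr0.
by rewrite dpart_zn.
Qed.

Lemma poly_der_ext (S T : poly -> poly) : derivation S -> derivation T ->
  (forall k : nat, S (zvar (inl k)) = T (zvar (inl k))) ->
  (forall n, n != 0 -> S (znvar R n) = T (znvar R n)) -> S =1 T.
Proof.
move=> SD TD STk STn; apply: derivation_eq => // -[k|m]; first exact: STk.
have := STn (val m) (valP m).
by rewrite /znvar valK.
Qed.

Lemma inclE : @incl R d = lin_ext (fun p => basis R (inl p)).
Proof. by rewrite basis.unlock. Qed.

Lemma incl_linear : linear (@incl R d).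
Proof. by rewrite inclE; exact: lin_ext_linear. Qed.

Lemma dir_incl u i : dir i (incl u) = 0.
Proof.
move: u; apply: (@linear_malg_eq R _ R^o) => [a u v|a u v|p].
- by rewrite incl_linear dir_linear.
- by rewrite scaler0 addr0.
by rewrite inclE lin_ext_basis /dir mcoeff_basis.
Qed.

Lemma part_incl_zD g m n : 0 <= mdegree g ->
  part n (incl (zD R g m)) = if m == n then basis R g else 0.
Proof.
move=> g0; rewrite /zD (insubT (fun g : midx d => 0 <= mdegree g) g0).
by rewrite basisE inclE lin_ext_basis /part lin_ext_basis.
Qed.

Lemma actE (T : poly -> poly) g n :
  act T g n = lin_ext (fun b => zD R b n) (T (basis R g)).
Proof.
rewrite /act /lin_ext (@fsbigTE _ _ _ _ (msupp (T (basis R g)))) => [|b].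
  by apply: eq_bigr => b _; rewrite /dcoef zmonE.
by rewrite /dcoef zmonE => /mcoeff_outdom ->; rewrite scale0r.
Qed.

Lemma dcoef_basis (T : poly -> poly) g b : (T (basis R g))@_b = dcoef T g b.
Proof. by rewrite /dcoef zmonE. Qed.

(** The degree condition ensures that no term of [T z^g] is dropped when it is
    read in the basis of monomials of nonnegative degree. *)
Lemma part_incl_act (T : poly -> poly) g m n :
  (forall b, dcoef T g b != 0 -> 0 <= mdegree b) ->
  part n (incl (act T g m)) = if m == n then T (basis R g) else 0.
Proof.
move=> Tge0; rewrite actE.
have lin : linear (fun u => part n (incl u)).
  by move=> a u v; rewrite incl_linear part_linear.
rewrite (linear_lin_ext _ _ lin).
rewrite (@eq_lin_ext _ _ _ _ (fun b => if m == n then basis R b else 0)); last first.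
  by move=> b /= bT; rewrite part_incl_zD // Tge0 // -dcoef_basis.
case: (m == n); first by rewrite lin_ext_id.
by rewrite /lin_ext big1 // => b _; rewrite scaler0.
Qed.

Lemma part_incl_lower (p : pidx d) m i n :
  part n (incl (lower R (val p) m i)) =
  (n i).+1%:R *: (if m == n + evec i then basis R (val p) else 0).
Proof.
rewrite /lower (scalable_linear incl_linear) (scalable_linear (part_linear n)).
rewrite (part_incl_zD _ _ (valP p)) /=.
have addE j : (n + evec i) j = (n j + (i == j))%N by rewrite !ffunE.
(* [sub_evec m i = n] has the extra solution m = n when m i = 0, and then the
   coefficient m i vanishes. *)
case: (m =P n + evec i) => [mE|mE].
  have -> : sub_evec m i = n.
    by apply/ffunP => j; rewrite ffunE mE addE addnK.
  by rewrite eqxx mE addE eqxx addn1.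
case: eqP => [nE|_]; last by rewrite !scaler0.
have [mi0|mi] := eqVneq (m i) 0%N; first by rewrite mi0 scale0r scaler0.
case: mE; apply/ffunP => j; rewrite addE -nE ffunE subnK //.
by case: eqVneq => [<-|//]; rewrite lt0n.
Qed.

Lemma bracket0_bilinear : bilinear_for *:%R *:%R (@bracket0 R d).
Proof. exact: bilin_ext_bilinear. Qed.

Lemma hat_prelie_bilinear : bilinear_for *:%R *:%R (@hat_prelie R d).
Proof. exact: bilin_ext_bilinear. Qed.

Lemma dir_inclN u i : dir i (- incl u) = 0.
Proof. by rewrite /dir mcoeffN -/(dir i (incl u)) dir_incl oppr0. Qed.

Lemma dir_bracket0 x y i : dir i (bracket0 x y) = 0.
Proof.
move: x y; apply: (@bilinear_malg_eq R _ _ R^o) => [||k l].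
- exact: (bilinear_comp (W := R^o) (dir_linear i) bracket0_bilinear).
- exact: bilinear0.
rewrite /bracket0 bilin_ext_basis; case: k l => [[g m]|i'] [[h m']|j].
- by rewrite /dir mcoeff0.
- exact: dir_incl.
- exact: dir_inclN.
- by rewrite /dir mcoeff0.
Qed.

Lemma dir_hat_prelie x y i : dir i (hat_prelie x y) = 0.
Proof.
move: x y; apply: (@bilinear_malg_eq R _ _ R^o) => [||k l].
- exact: (bilinear_comp (W := R^o) (dir_linear i) hat_prelie_bilinear).
- exact: bilinear0.
rewrite /hat_prelie bilin_ext_basis; case: k l => [[g m]|i'] [[h m']|j].
- exact: dir_incl.
- by rewrite /dir mcoeff0.
- exact: dir_incl.
- by rewrite /dir mcoeff0.
Qed.

Lemma dir_basis_inl p i : dir i (basis R (inl p : Lspace_basis d)) = 0.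
Proof. by rewrite /dir mcoeff_basis. Qed.

Lemma part_basis_inr n i : part n (basis R (inr i : Lspace_basis d)) = 0.
Proof. by rewrite /part lin_ext_basis. Qed.

Lemma part_bracket0 x y n : part n (bracket0 x y) =
  dshift (dir^~ y) (part^~ x) n - dshift (dir^~ x) (part^~ y) n.
Proof.
have sh_bilinear : bilinear_for *:%R *:%R
    (fun x y => dshift (dir^~ y) (part^~ x) n).
  split=> [z|z] a u v.
    by rewrite -dshiftP; apply: eq_dshift => m; rewrite part_linear.
  by rewrite -dshiftPl; apply: eq_bigr => i _; rewrite dir_linear.
move: x y; apply: bilinear_malg_eq => [||k l].
- exact: (bilinear_comp (part_linear n) bracket0_bilinear).
- exact: (bilinear_skew sh_bilinear).
have sh_inr u i : dshift (dir^~ (basis R (inr i : Lspace_basis d))) (part^~ u) n =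
    (n i).+1%:R *: part (n + evec i) u.
  rewrite -(dshift_delta i (part^~ u)); apply: eq_bigr => j _.
  by rewrite /dir mcoeff_basis.
have sh_inl u p : dshift (dir^~ (basis R (inl p : Lspace_basis d))) (part^~ u) n = 0.
  by rewrite dshift0 // => i; rewrite dir_basis_inl.
rewrite /bracket0 bilin_ext_basis; case: k l => [[g m]|i] [[h m']|j].
- by rewrite !sh_inl subrr (part0 part_linear).
- by rewrite sh_inl sh_inr subr0 part_incl_lower /part lin_ext_basis.
- rewrite sh_inl sh_inr sub0r -[- incl _]sub0r (partB part_linear).
  by rewrite (part0 part_linear) sub0r part_incl_lower /part lin_ext_basis.
- by rewrite !sh_inr !part_basis_inr !scaler0 subrr (part0 part_linear).
Qed.

Lemma part_hat_prelie x y n : part n (hat_prelie x y) = op x (part n y).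
Proof.
move: x y; apply: bilinear_malg_eq => [||k l].
- exact: (bilinear_comp (part_linear n) hat_prelie_bilinear).
- split=> [z|z] a u v; first by rewrite op_linear.
  by rewrite part_linear (der_linear (op_der z)).
have op_if u (b : bool) P : op u (if b then P else 0) = if b then op u P else 0.
  by case: b => //; exact: der0 (op_der u).
rewrite /hat_prelie bilin_ext_basis; case: l => [[h m']|j]; last first.
  rewrite part_basis_inr (op_if _ false 0).
  by case: k => [[g m]|i]; rewrite (part0 part_linear).
rewrite {2}/part lin_ext_basis op_if /op lin_ext_basis.
case: k => [[g m]|i].
  rewrite /prelie !basisE bilin_ext_basis part_incl_act => [|b].
    by rewrite /zD_op zmonE.
  exact: (dcoef_zD_op_mdegree (valP g) (valP h)).
rewrite part_incl_act // => b.
exact: (dcoef_dpart_mdegree (valP h)).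
Qed.

Lemma post_lie_bracketE x y : post_lie_bracket x y = lie_bracket x y.
Proof.
move: x y; apply: bilinear_malg_eq => [||k l].
- exact: (dbr_bilinear bracket0_bilinear hat_prelie_bilinear).
- exact: bilin_ext_bilinear.
rewrite /post_lie_bracket /bracket0 /hat_prelie /lie_bracket !bilin_ext_basis.
have inclB : {morph @incl R d : u v / u - v}.
  exact: (zmod_morphism_linear incl_linear).
case: k l => [[g m]|i] [[h m']|j].
- by rewrite !basisE /prelie !bilin_ext_basis inclB add0r.
- by rewrite inclB addr0.
- by rewrite inclB subr0 opprB addrC.
- by rewrite addr0 subr0.
Qed.

End Concrete.

Theorem theorem5p5 (R : realType) (d : nat) :
  is_post_lie (V := Lspace R d) (@bracket0 R d) (@hat_prelie R d) /\
  is_lie_bracket (V := Lspace R d) (@post_lie_bracket R d) /\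
  (forall x y : Lspace R d, post_lie_bracket x y = lie_bracket x y).
Proof.
have [post_lie lie] := model_post_lie (@part_linear R d) (@op_linear R d)
  (@part_faithful R d) (@dir_linear R d) (@op_der R d) (@poly_der_ext R d)
  (@op_zk R d) (@op_zn R d) (@bracket0_bilinear R d) (@hat_prelie_bilinear R d)
  (@part_bracket0 R d) (@dir_bracket0 R d) (@part_hat_prelie R d)
  (@dir_hat_prelie R d).
by split; [exact: post_lie | split; [exact: lie | exact: post_lie_bracketE]].
Qed.
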